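(* For every non-negative integer $L$ and every positive integer $k$, \[ \sum_{j=-L}^{L}\left(\frac{j+1}{3}\right)q^{kj(j-1)}{2L\brack L-j}_q = q^L\sum_{j=-L}^{L}\left(\frac{j+1}{3}\right)q^{kj^2-(k-1)j}{2L\brack L-j}_q. \]
   Context: $(a;q)_n=\prod_{k=0}^{n-1}(1-aq^k)$. The $q$-binomial coefficient is ${m+n\brack m}_q=\frac{(q;q)_{m+n}}{(q;q)_m(q;q)_n}$ for $m,n\ge 0$ and $0$ otherwise. $\left(\frac{a}{3}\right)$ denotes the Jacobi symbol modulo 3: $0$ if $3\mid a$, $1$ if $a\equiv1\pmod 3$, $-1$ if $a\equiv 2\pmod 3$. *)

(* Defs.v *)
From mathcomp Require Import all_boot all_order all_algebra.
Set Implicit Arguments.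
Unset Strict Implicit.
Unset Printing Implicit Defensive.
Import Order.TTheory GRing.Theory Num.Theory.
Local Open Scope ring_scope.

Definition qpoch (F : fieldType) (a q : F) (n : nat) : F :=
  \prod_(k < n) (1 - a * q ^+ k).

(* The coefficient [N, m]_q with N = m + n: it is 0 unless m >= 0 and
   n = N - m >= 0. The quotient has its usual meaning when q ^+ n != 1 for all
   n > 0, since the denominator is then nonzero. *)
Definition qbinom (F : fieldType) (q : F) (N m : int) : F :=
  if (0 <= m) && (0 <= N - m) then
    qpoch q q `|N|%N / (qpoch q q `|m|%N * qpoch q q `|N - m|%N)
  else 0.

Definition jacobi3 (a : int) : int :=
  if (3 %| a)%Z then 0 else if (a == 1 %[mod 3])%Z then 1 else -1.

(* The integers -L, -L + 1, ..., L in increasing order. *)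
Definition symrange (L : nat) : seq int :=
  [seq i%:Z - L%:Z | i <- iota 0 (2 * L).+1].

(* Main.v *)
Require Import Defs.
From mathcomp Require Import all_boot all_order all_algebra.
From mathcomp Require Import zify ring.
Import Order.TTheory GRing.Theory Num.Theory.
Local Open Scope ring_scope.

(** The difference of the two sides is the sum over [-L <= j <= L] of
    [jacobi3 (j + 1) * q ^ (k j (j - 1)) * (1 - q ^ (L + j)) * [2L, L - j]].
    The term [j = -L] vanishes. Otherwise
    [(1 - q ^ (L + j)) [2L, L - j] = (q; q)_(2L) / ((q; q)_(L - j) (q; q)_(L + j - 1))]
    is invariant under the fixed-point-free involution [j -> 1 - j], as is
    [j (j - 1)], while [jacobi3 (j + 1)] changes sign; so the terms cancel in
    pairs. *)

Lemma qpochS (F : fieldType) (a q : F) (n : nat) :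
  qpoch a q n.+1 = qpoch a q n * (1 - a * q ^+ n).
Proof. by rewrite /qpoch big_ord_recr. Qed.

(** The factor [1 - q ^+ n.+1], nonzero by hypothesis, is the last one of [qpoch q q n.+1] in the
    denominator and cancels. *)
Lemma subr_expn_mul_qbinom (F : fieldType) (q : F) (m n : nat) :
  q ^+ n.+1 <> 1 ->
  (1 - q ^+ n.+1) * qbinom q (m + n).+1%:Z m%:Z
  = qpoch q q (m + n).+1 / (qpoch q q m * qpoch q q n).
Proof.
move=> hq; have nz : 1 - q ^+ n.+1 != 0.
  by rewrite subr_eq0 eq_sym; apply/eqP.
have -> : qbinom q (m + n).+1%:Z m%:Z
    = qpoch q q (m + n).+1 / (qpoch q q m * qpoch q q n.+1).
  rewrite /qbinom (_ : (m + n).+1%:Z - m%:Z = n.+1%:Z) //; lia.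
by rewrite (qpochS _ _ _ n) -exprS !invfM mulrCA [X in _ * X]mulrCA
  [X in _ * (_ * X)]mulrCA mulfV // mulr1.
Qed.

Lemma jacobi3N (a : int) : jacobi3 (- a) = - jacobi3 a.
Proof.
rewrite /jacobi3.
by case: ifP => h1; case: ifP => h2; try case: ifP => h3; try case: ifP => h4; lia.
Qed.

Lemma jacobi3D3 (a : int) : jacobi3 (a + 3) = jacobi3 a.
Proof.
rewrite /jacobi3 modzDr (_ : (3 %| a + 3)%Z = (3 %| a)%Z) //; lia.
Qed.

(* Unlike [exprzDr], this does not require [x] to be a unit. *)
Lemma exprzD_ge0 (R : unitRingType) (x : R) (m n : int) :
  0 <= m -> 0 <= n -> x ^ (m + n) = x ^ m * x ^ n.
Proof. by case: m n => [m|//] [n|//] _ _; rewrite -PoszD -!exprnP exprD. Qed.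

(** Reversal swaps the halves [1..L] and [L+1..2L], so terms cancel in pairs without any division by
    2. *)
Lemma big_nat_antisym_eq0 (V : zmodType) (T : nat -> V) (L : nat) :
  (forall i, (0 < i <= 2 * L)%N -> T ((2 * L).+1 - i)%N = - T i) ->
  \sum_(1 <= i < (2 * L).+1) T i = 0.
Proof.
move=> hT; rewrite (@big_cat_nat _ _ _ L.+1) /=; [|lia|lia].
rewrite [X in _ + X]big_nat_rev /= -{2}[L.+1]add1n [X in _ + X]big_addn /=.
rewrite (_ : ((2 * L).+1 - L)%N = L.+1); last lia.
rewrite -big_split big_nat big1 //= => i hi.
rewrite (_ : _ - _ = (2 * L).+1 - i)%N; last lia.
rewrite hT ?subrr //; lia.
Qed.

Theorem theorem12 (F : fieldType) (q : F)
    (hq : forall n : nat, (0 < n)%N -> q ^+ n <> 1)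
    (L k : nat) (hk : (0 < k)%N) :
  \sum_(j <- symrange L)
      (jacobi3 (j + 1))%:~R * q ^ (k%:Z * j * (j - 1))
        * qbinom q (2 * L%:Z) (L%:Z - j)
  = q ^+ L * \sum_(j <- symrange L)
      (jacobi3 (j + 1))%:~R * q ^ (k%:Z * j ^+ 2 - (k%:Z - 1) * j)
        * qbinom q (2 * L%:Z) (L%:Z - j).
Proof.
apply/eqP; rewrite -subr_eq0 mulr_sumr -sumrB /symrange big_map; apply/eqP.
(* With [i = L + j], the involution [j -> 1 - j] becomes [i -> 2L + 1 - i]. *)
pose T (i : nat) : F := let j := i%:Z - L%:Z in
  (jacobi3 (j + 1))%:~R * q ^ (k%:Z * (j * (j - 1)))
    * ((1 - q ^+ i) * qbinom q (2 * L%:Z) (L%:Z - j)).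
rewrite (eq_bigr T) => [|i _]; last first.
  rewrite /T /=; set j := i%:Z - L%:Z.
  (* Since [q] may be 0, powers are split only at nonnegative exponents. *)
  have hj : 0 <= j * (j - 1) by nia.
  have he : 0 <= k%:Z * (j * (j - 1)) by nia.
  have he' : 0 <= k%:Z * j ^+ 2 - (k%:Z - 1) * j.
    by rewrite expr2; case: (lerP 0 j) => ?; nia.
  have hpow : q ^+ L * q ^ (k%:Z * j ^+ 2 - (k%:Z - 1) * j)
      = q ^ (k%:Z * (j * (j - 1))) * q ^+ i.
    rewrite !exprnP -!exprzD_ge0 //; congr (q ^ _); rewrite /j; ring.
  by rewrite -[k%:Z * j * _]mulrA; ring: hpow.
rewrite -[iota _ _]/(index_iota 0 (2 * L).+1) big_ltn //.
rewrite {1}/T /= expr0 subrr mul0r mulr0 add0r.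
apply: big_nat_antisym_eq0 => i /andP[i_gt0 le_i].
(* Here [m = L - j] and [n = L + j - 1]; the involution exchanges them, and the quotient is
   symmetric in them. *)
have TE (m n : nat) : (m + n).+1 = (2 * L)%N ->
    T n.+1 = (jacobi3 (n.+1%:Z - L%:Z + 1))%:~R
      * q ^ (k%:Z * ((n.+1%:Z - L%:Z) * (n.+1%:Z - L%:Z - 1)))
      * (qpoch q q (2 * L) / (qpoch q q m * qpoch q q n)).
  move=> mn; rewrite /T -mn -(@subr_expn_mul_qbinom _ q m n); last exact: hq.
  by do 2!congr (_ * _); congr qbinom; lia.
case: i i_gt0 le_i => [//|n] _ le_n.
pose m := (2 * L - n.+1)%N.
rewrite (_ : (2 * L).+1 - n.+1 = m.+1)%N; last lia.
rewrite (TE n m) ?(TE m n); [|lia|lia].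
rewrite (_ : m.+1%:Z - L%:Z = 1 - (n.+1%:Z - L%:Z)); last lia.
set j := n.+1%:Z - L%:Z.
(* The sign change comes from [2 - j] being congruent to [-(j + 1)] modulo 3. *)
rewrite (_ : 1 - j + 1 = - (j + 1) + 3); last ring.
rewrite jacobi3D3 jacobi3N mulrNz !mulNr [qpoch q q n * _]mulrC.
by congr (- (_ * q ^ _ * _)); ring.
Qed.
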